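(* Let $r>0$ and $\alpha=e^{-r}$, and let $c>0$. Let $\phi:[-1,0]\to\mathbb{R}$ be a continuous function satisfying $$0<\phi(s)\le ce^{rs},\quad s\in[-1,0],\qquad \phi(0)=c,\qquad \phi(-1)<ce^{-r}.$$ Let $x$ be the solution of $$\frac{d}{dt}x(t)=r\,x(t)\left(1+\alpha x(t)-x(t-1)\right)$$ with initial function $\phi$. Then $x(t)>ce^{rt}$ for all $t>0$ in the interval of existence of $x$, and $x$ blows up at a finite time.
   Context: The solution with initial function $\phi$ is the continuous function $x$ on its maximal interval of existence $[-1,T)$, $0<T\le\infty$, with $x(\theta)=\phi(\theta)$ for $\theta\in[-1,0]$ and satisfying the differential equation for $0\le t<T$ (right-hand derivative at $t=0$). The solution blows up at a finite time if $T<\infty$ and $\lim_{t\to T^-}x(t)=\infty$. *)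

(* Defs.v *)
(* Stdlib reals with Coquelicot. *)
From Stdlib Require Export Reals.
From Coquelicot Require Export Coquelicot.
Open Scope R_scope.

(* [x] solves x'(t) = r x(t) (1 + alpha x(t) - x(t-1)) on [0, T) with initial
   function [phi] on [-1, 0]. Functions on [-1, 0] and [-1, T) are total
   functions on R whose values outside these intervals play no role. *)
Definition is_solution (r alpha : R) (phi x : R -> R) (T : Rbar) : Prop :=
  let rhs t := r * x t * (1 + alpha * x t - x (t - 1)) in
  Rbar_lt 0 T /\
  continuous_on (fun t : R => -1 <= t /\ Rbar_lt t T) x /\
  (forall s : R, -1 <= s <= 0 -> x s = phi s) /\
  filterlim (fun t : R => (x t - x 0) / (t - 0)) (at_right 0) (locally (rhs 0)) /\
  (forall t : R, 0 < t -> Rbar_lt t T -> is_derive x t (rhs t)).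

(* No solution on a strictly longer interval extends [x]. *)
Definition is_maximal_solution (r alpha : R) (phi x : R -> R) (T : Rbar) : Prop :=
  is_solution r alpha phi x T /\
  (forall (y : R -> R) (T' : Rbar),
     is_solution r alpha phi y T' ->
     (forall t : R, -1 <= t -> Rbar_lt t T -> y t = x t) ->
     Rbar_le T' T).

Definition blows_up_at_finite_time (x : R -> R) (T : Rbar) : Prop :=
  exists b : R, T = Finite b /\ filterlim x (at_left b) (Rbar_locally p_infty).

(* Main.v *)
(* For Y(t) = x(t) e^(-rt) the equation reads Y' = r alpha e^(rt) Y (Y - Y(t-1)).
   Until the first zero of min(Y, Y - Y(t-1)) the function Y increases strictly,
   so there is no such zero and Y > c. If x were global, the mean value theorem
   on [t-1, t] would first bound Y - Y(t-1) below by a positive constant, then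
   by Y/2, so that eventually Y' >= Y^2, which is absurd. Hence the existence
   interval is finite; the increasing function x has a limit there, and a finite
   limit would allow a continuation, since 1/x solves a linear equation whose
   delayed coefficient is already known. *)
Require Import Defs.
From Stdlib Require Import Reals Lra Classical.
From Coquelicot Require Import Coquelicot.
Open Scope R_scope.

(** * Continuity, mean value and continuous induction *)

Lemma locally_Rbar_lt (T : Rbar) (t : R) :
  Rbar_lt t T -> locally t (fun u : R => Rbar_lt u T).
Proof.
destruct T as [b| |]; simpl; intros Ht.
- exact (open_lt b t Ht).
- now apply filter_forall.
- contradiction.
Qed.

Lemma continuous_pos (f : R -> R) (t : R) :
  continuous f t -> 0 < f t -> locally t (fun u => 0 < f u).
Proof.
intros Hf H0. apply (Hf (fun z => 0 < z)). exact (open_gt 0 (f t) H0).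
Qed.

Lemma continuous_Rmin (f g : R -> R) (t : R) :
  continuous f t -> continuous g t -> continuous (fun u => Rmin (f u) (g u)) t.
Proof.
intros Hf Hg.
apply continuous_ext with (fun u => (f u + g u - Rabs (f u - g u)) / 2).
{ intros u. unfold Rmin, Rabs.
  destruct (Rle_dec _ _); destruct (Rcase_abs _); lra. }
apply (continuous_mult (K := R_AbsRing)); [|apply continuous_const].
apply (continuous_minus (V := R_NormedModule)).
- now apply (continuous_plus (V := R_NormedModule)).
- apply (continuous_comp (fun u => f u - g u) Rabs).
  + now apply (continuous_minus (V := R_NormedModule)).
  + apply continuous_Rabs.
Qed.

(** Differentiability is asked only inside the interval, so that the lemma also applies from time 0,
    where the equation holds one-sidedly. *)
Lemma mean_value (f df : R -> R) (a b : R) :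
  a < b ->
  (forall t, a < t < b -> is_derive f t (df t)) ->
  (forall t, a <= t <= b -> continuous f t) ->
  exists xi, a < xi < b /\ f b - f a = df xi * (b - a).
Proof.
intros Hab Hd Hc.
assert (pr : forall t, a < t < b -> derivable_pt f t).
{ intros t Ht. exists (df t). apply is_derive_Reals. now apply Hd. }
destruct (MVT f id a b pr (fun t _ => derivable_pt_id t) Hab) as [xi [P H]].
- intros t Ht. apply continuity_pt_filterlim. now apply Hc.
- intros t _. apply derivable_continuous_pt, derivable_pt_id.
- exists xi. split; [exact P|].
  rewrite derive_pt_id in H. unfold id in H.
  rewrite (derive_pt_eq_0 f xi (df xi) (pr xi P)) in H.
  + lra.
  + apply is_derive_Reals. now apply Hd.
Qed.

(** Continuous induction: let [m] be the supremum of the [u] with [f] positive on [0, u]. The step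
    hypothesis gives positivity at [m], and continuity then carries it past [m]. *)
Lemma positive_propagation (f : R -> R) (b : R) :
  (forall t, 0 <= t <= b -> continuous f t) ->
  0 < f 0 ->
  (forall t, 0 < t <= b -> (forall s, 0 <= s < t -> 0 < f s) -> 0 < f t) ->
  forall t, 0 <= t <= b -> 0 < f t.
Proof.
intros Hc H0 Hstep t Ht.
destruct (Rlt_le_dec 0 (f t)) as [|Hneg]; [assumption|exfalso].
set (E := fun u => 0 <= u <= t /\ forall s, 0 <= s <= u -> 0 < f s).
assert (E0 : E 0).
{ split; [lra|]. intros s Hs. now replace s with 0 by lra. }
destruct (completeness E) as [m [Hub Hlub]].
- exists t. intros u [Hu _]. lra.
- now exists 0.
- assert (Hm0 : 0 <= m) by now apply Hub.
  assert (Hmt : m <= t) by (apply Hlub; intros u [Hu _]; lra).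
  assert (Hbelow : forall s, 0 <= s < m -> 0 < f s).
  { intros s Hs. apply NNPP. intros Hn.
    assert (m <= s); [|lra].
    apply Hlub. intros u [Hu HEu].
    destruct (Rle_lt_dec u s); [assumption|].
    exfalso. apply Hn, HEu. lra. }
  assert (Hfm : 0 < f m).
  { destruct (Req_dec m 0) as [->|Hm]; [assumption|].
    apply Hstep; [lra|assumption]. }
  assert (m < t).
  { destruct (Req_dec m t) as [->|]; lra. }
  destruct (continuous_pos f m) as [eps Heps]; [apply Hc; lra|assumption|].
  assert (He := cond_pos eps).
  set (u := Rmin t (m + eps / 2)).
  assert (Hu1 : m < u) by (apply Rmin_glb_lt; lra).
  assert (Hu2 : u <= t) by apply Rmin_l.
  assert (Hu3 : u <= m + eps / 2) by apply Rmin_r.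
  assert (u <= m); [|lra].
  apply Hub. split; [lra|]. intros s Hs.
  destruct (Rlt_le_dec s m) as [Hsm|Hsm]; [apply Hbelow; lra|].
  apply Heps. change (Rabs (s - m) < eps). apply Rabs_def1; lra.
Qed.

(** * Growth of the normalized solution *)

Section Normalized.

(* [Y t] stands for [x t * exp (- r * t)], and [p t] for [r * alpha * exp (r * t)]. *)
Variables (p Y : R -> R) (T : Rbar).
Hypothesis hp : forall t, 0 <= t -> 0 < p t.
Hypothesis hc : forall t : R, Rbar_lt t T -> continuous Y t.
Hypothesis hd : forall t : R, 0 < t -> Rbar_lt t T ->
  is_derive Y t (p t * Y t * (Y t - Y (t - 1))).
Hypothesis hY0 : 0 < Y 0.
Hypothesis hist : forall s, -1 <= s <= 0 -> Y s <= Y 0.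
Hypothesis hY1 : Y (-1) < Y 0.

Lemma Rbar_lt_below (s t : R) : s <= t -> Rbar_lt t T -> Rbar_lt s T.
Proof. intros Hst. now apply Rbar_le_lt_trans. Qed.

Lemma continuous_delay_difference (t : R) :
  Rbar_lt t T -> continuous (fun u => Y u - Y (u - 1)) t.
Proof.
intros Ht. apply (continuous_minus (V := R_NormedModule)); [now apply hc|].
apply (continuous_comp (fun u => u - 1) Y).
- apply (ex_derive_continuous (V := R_NormedModule)). auto_derive. exact I.
- apply hc, (Rbar_lt_below _ t); [lra|assumption].
Qed.

(** All three factors of Y' are positive inside (s, b). Nothing is assumed at [b] itself, which lets
    the lemma serve as the induction step of [min_pos]. *)
Lemma strictly_increasing_of_pos (b : R) :
  Rbar_lt b T ->
  (forall s, 0 <= s < b -> 0 < Rmin (Y s) (Y s - Y (s - 1))) ->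
  forall s, 0 <= s < b -> Y s < Y b.
Proof.
intros Hb Hpos s Hs.
destruct (mean_value Y (fun t => p t * Y t * (Y t - Y (t - 1))) s b)
  as [xi [Hxi E]].
- lra.
- intros t Ht. apply hd; [lra|]. apply (Rbar_lt_below _ b); [lra|assumption].
- intros t Ht. apply hc, (Rbar_lt_below _ b); [lra|assumption].
- assert (P := Hpos xi ltac:(lra)).
  assert (0 < Y xi) by (eapply Rlt_le_trans; [exact P|apply Rmin_l]).
  assert (0 < Y xi - Y (xi - 1)) by (eapply Rlt_le_trans; [exact P|apply Rmin_r]).
  assert (0 < p xi) by (apply hp; lra).
  assert (0 < p xi * Y xi * (Y xi - Y (xi - 1)) * (b - s)).
  { repeat apply Rmult_lt_0_compat; lra. }
  lra.
Qed.

(** Continuous induction on the minimum. As long as it is positive, [Y] increases; at the next time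
    [b] the delayed point [b - 1] lies either in [0, b), where monotonicity applies, or in the
    history, where [Y <= Y 0 < Y b]. The start at 0 uses the strict inequality [hY1]. *)
Lemma min_pos (t : R) :
  0 <= t -> Rbar_lt t T -> 0 < Rmin (Y t) (Y t - Y (t - 1)).
Proof.
intros H0 Ht.
apply (positive_propagation (fun s => Rmin (Y s) (Y s - Y (s - 1))) t); [| | |lra].
- intros s Hs.
  assert (Hs' : Rbar_lt s T) by (apply (Rbar_lt_below _ t); [lra|assumption]).
  apply (continuous_Rmin Y (fun s => Y s - Y (s - 1)));
    [now apply hc|now apply continuous_delay_difference].
- apply Rmin_glb_lt; [assumption|]. replace (0 - 1) with (-1) by lra. lra.
- intros b Hb Hpos.
  assert (Hb' : Rbar_lt b T) by (apply (Rbar_lt_below _ t); [lra|assumption]).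
  assert (Hinc := strictly_increasing_of_pos b Hb' Hpos).
  assert (Y 0 < Y b) by (apply Hinc; lra).
  apply Rmin_glb_lt; [lra|].
  destruct (Rle_lt_dec 0 (b - 1)) as [Hb1|Hb1].
  + assert (Y (b - 1) < Y b) by (apply Hinc; lra). lra.
  + assert (Y (b - 1) <= Y 0) by (apply hist; lra). lra.
Qed.

Lemma strictly_increasing (s t : R) :
  0 <= s < t -> Rbar_lt t T -> Y s < Y t.
Proof.
intros Hst Ht. apply strictly_increasing_of_pos; [assumption| |assumption].
intros u Hu. apply min_pos; [lra|]. apply (Rbar_lt_below _ t); [lra|assumption].
Qed.

Lemma ge_initial (t : R) : 0 <= t -> Rbar_lt t T -> Y 0 <= Y t.
Proof.
intros H0 Ht. destruct (Req_dec t 0) as [->|]; [lra|].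
apply Rlt_le, strictly_increasing; [lra|assumption].
Qed.

Lemma delay_difference_pos (t : R) :
  0 <= t -> Rbar_lt t T -> 0 < Y t - Y (t - 1).
Proof.
intros H0 Ht. eapply Rlt_le_trans; [now apply (min_pos t)|apply Rmin_r].
Qed.

Lemma interval_finite :
  (forall M, exists t0, forall t, t0 <= t -> M <= p t) -> T <> p_infty.
Proof.
intros Hp HT.
assert (Hglob : forall t : R, Rbar_lt t T) by (intros t; now rewrite HT).
set (d := fun t => Y t - Y (t - 1)).
assert (dpos : forall t, 0 <= t -> 0 < d t).
{ intros t Ht. now apply delay_difference_pos. }
assert (Yge : forall t, 0 <= t -> Y 0 <= Y t).
{ intros t Ht. now apply ge_initial. }
assert (Hmv : forall t, 1 <= t -> exists xi, t - 1 < xi < t /\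
  d t = p xi * Y xi * d xi).
{ intros t Ht.
  destruct (mean_value Y (fun t => p t * Y t * d t) (t - 1) t) as [xi [Hxi E]].
  - lra.
  - intros u Hu. apply hd; [lra|apply Hglob].
  - intros u _. apply hc. apply Hglob.
  - exists xi. split; [assumption|].
    unfold d at 1. rewrite E. ring. }
assert (dcont : forall t, continuity_pt d t).
{ intros t. apply continuity_pt_filterlim.
  now apply continuous_delay_difference. }
(* Since [Y 0 <= Y], this bound on [p] gives [p * Y >= 2], so [Hmv] makes [d t] at least twice an
   earlier value of [d]. The unit added in [t1] keeps the intermediate point beyond [t0]. *)
destruct (Hp (2 / Y 0)) as [t0 Ht0].
set (t1 := Rmax 1 (t0 + 1)).
assert (Ht1 : 1 <= t1) by apply Rmax_l.
assert (Ht1' : t0 + 1 <= t1) by apply Rmax_r.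
(* Going back from [t] by less than one unit of time one finds a smaller
   value of [d], so [d] is minimized on the initial unit interval. *)
assert (Hsmall : forall t, t1 <= t -> exists xi, t - 1 < xi < t /\ d xi < d t).
{ intros t Ht. destruct (Hmv t) as [xi [Hxi E]]; [lra|].
  exists xi. split; [assumption|]. rewrite E.
  assert (A1 : 2 / Y 0 <= p xi) by (apply Ht0; lra).
  assert (A2 : Y 0 <= Y xi) by (apply Yge; lra).
  assert (A3 : 0 < d xi) by (apply dpos; lra).
  assert (A4 : 2 <= p xi * Y xi).
  { replace 2 with (2 / Y 0 * Y 0) by (field; lra).
    apply Rmult_le_compat; try lra.
    apply Rlt_le, Rdiv_lt_0_compat; lra. }
  nra. }
destruct (continuity_ab_min d (t1 - 1) t1) as [tau [Htau Htau']];
  [lra|intros; apply dcont|].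
set (m := d tau).
assert (Hm : 0 < m) by (apply dpos; lra).
(* A minimizer [u] over the longer interval cannot exceed [t1]: [Hsmall] would give a smaller value
   still inside that interval. *)
assert (dge : forall t, t1 - 1 <= t -> m <= d t).
{ intros t Ht.
  destruct (continuity_ab_min d (t1 - 1) (Rmax t t1)) as [u [Hu Hu']].
  - assert (A := Rmax_r t t1). lra.
  - intros; apply dcont.
  - assert (A := Rmax_l t t1).
    apply Rle_trans with (d u); [|apply Hu; lra].
    destruct (Rle_lt_dec u t1) as [H|H]; [apply Htau; lra|].
    destruct (Hsmall u) as [xi [Hxi Hlt]]; [lra|].
    assert (d u <= d xi) by (apply Hu; lra). lra. }
(* The bound [/ m] yields [p * d >= 1], used in [dhalf]; the bound 2 turns [d >= Y / 2] into Y' >=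
   Y^2. *)
destruct (Hp (Rmax 2 (/ m))) as [t2 Ht2].
set (t3 := Rmax t1 (t2 + 1)).
assert (Ht3 : t1 <= t3) by apply Rmax_l.
assert (Ht3' : t2 + 1 <= t3) by apply Rmax_r.
(* Here [d t >= Y xi > Y (t - 1) = Y t - d t]. *)
assert (dhalf : forall t, t3 <= t -> Y t / 2 <= d t).
{ intros t Ht. destruct (Hmv t) as [xi [Hxi E]]; [lra|].
  assert (A1 : / m <= p xi).
  { eapply Rle_trans; [apply Rmax_r|apply Ht2; lra]. }
  assert (A2 : m <= d xi) by (apply dge; lra).
  assert (A3 : Y (t - 1) < Y xi) by (apply strictly_increasing; [lra|apply Hglob]).
  assert (A4 : Y 0 <= Y xi) by (apply Yge; lra).
  assert (A5 : 1 <= p xi * d xi).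
  { replace 1 with (/ m * m) by (field; lra).
    apply Rmult_le_compat; try lra.
    apply Rlt_le, Rinv_0_lt_compat; lra. }
  assert (A6 : Y xi <= d t) by (rewrite E; nra).
  unfold d in *. lra. }
assert (Y3 : Y 0 <= Y t3) by (apply Yge; lra).
(* Y' >= Y^2 means that 1/Y has slope at most -1, so it would be nonpositive by time [b]. *)
set (b := t3 + / Y t3).
assert (HI : 0 < / Y t3) by (apply Rinv_0_lt_compat; lra).
destruct (mean_value (fun t => / Y t) (fun t => - (p t * Y t * d t) / Y t ^ 2) t3 b)
  as [xi [Hxi E]].
- unfold b; lra.
- intros t Ht. assert (Y 0 <= Y t) by (apply Yge; lra).
  apply (is_derive_inv Y t); [apply hd; [lra|apply Hglob]|lra].
- intros t Ht. assert (Y 0 <= Y t) by (apply Yge; lra).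
  apply (continuous_comp Y Rinv).
  + apply hc. apply Hglob.
  + apply (ex_derive_continuous (V := R_NormedModule)). auto_derive. lra.
- assert (A1 : Y 0 <= Y xi) by (apply Yge; lra).
  assert (A2 : Y xi / 2 <= d xi) by (apply dhalf; lra).
  assert (A3 : 2 <= p xi).
  { eapply Rle_trans; [apply Rmax_l|apply Ht2; lra]. }
  assert (A4 : 1 <= (p xi * Y xi * d xi) / Y xi ^ 2).
  { replace ((p xi * Y xi * d xi) / Y xi ^ 2) with (p xi * (d xi / Y xi))
      by (field; lra).
    assert (/ 2 <= d xi / Y xi).
    { apply Rmult_le_reg_r with (Y xi); [lra|].
      replace (d xi / Y xi * Y xi) with (d xi) by (field; lra). lra. }
    nra. }
  assert (A5 : 0 < / Y b).
  { apply Rinv_0_lt_compat. assert (Y 0 <= Y b); [|lra].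
    apply Yge. unfold b; lra. }
  replace (- (p xi * Y xi * d xi) / Y xi ^ 2)
    with (- ((p xi * Y xi * d xi) / Y xi ^ 2)) in E by (field; lra).
  replace (b - t3) with (/ Y t3) in E by (unfold b; lra).
  nra.
Qed.

End Normalized.

(** * Limit at a finite endpoint and continuation beyond it *)

(** The limit is the supremum of the values on [0, b). The bound [f 0 <= L] later makes a finite
    limit positive, as inverting it requires. *)
Lemma increasing_limit_left (f : R -> R) (b : R) :
  0 < b ->
  (forall s t, 0 <= s < t -> t < b -> f s < f t) ->
  filterlim f (at_left b) (Rbar_locally p_infty) \/
  exists L, f 0 <= L /\ filterlim f (at_left b) (locally L).
Proof.
intros Hb Hinc.
assert (Hev : forall s, s < b -> at_left b (fun t => s < t < b)).
{ intros s Hs. assert (He : 0 < b - s) by lra.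
  exists (mkposreal _ He). intros t Ht Htb.
  change (Rabs (t - b) < b - s) in Ht. apply Rabs_def2 in Ht. lra. }
set (E := fun z => exists t, 0 <= t < b /\ z = f t).
destruct (classic (bound E)) as [HB|HB].
- right. destruct (completeness E HB) as [L [Hub Hlub]].
  { exists (f 0), 0. split; [lra|reflexivity]. }
  exists L. split; [apply Hub; exists 0; split; [lra|reflexivity]|].
  apply filterlim_locally. intros eps.
  assert (He := cond_pos eps).
  assert (Hs : exists s, 0 <= s < b /\ L - eps < f s).
  { apply NNPP. intros Hn. assert (L <= L - eps); [|lra].
    apply Hlub. intros z [t [Ht ->]].
    destruct (Rle_lt_dec (f t) (L - eps)); [assumption|].
    exfalso. apply Hn. now exists t. }
  destruct Hs as [s [Hs HL]].
  generalize (Hev s (proj2 Hs)). apply filter_imp. intros t Ht.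
  assert (f s < f t) by (apply Hinc; lra).
  assert (f t <= L) by (apply Hub; exists t; split; [lra|reflexivity]).
  change (Rabs (f t - L) < eps). apply Rabs_def1; lra.
- left. intros P [M HM]. unfold filtermap.
  assert (Hs : exists s, 0 <= s < b /\ M < f s).
  { apply NNPP. intros Hn. apply HB. exists M. intros z [t [Ht ->]].
    destruct (Rle_lt_dec (f t) M); [assumption|].
    exfalso. apply Hn. now exists t. }
  destruct Hs as [s [Hs HL]].
  generalize (Hev s (proj2 Hs)). apply filter_imp. intros t Ht.
  apply HM. assert (f s < f t) by (apply Hinc; lra). lra.
Qed.

(* The delayed term is known one unit of time ahead, and [1 / X] solves a linear
   equation, hence variation of constants gives it slightly beyond [b]. *)
Lemma bernoulli_extension (r alpha b L : R) (X : R -> R) :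
  0 < b ->
  (forall t, t < b -> continuous X t) ->
  (forall t, 0 < t < b -> 0 < X t) ->
  (forall t, 0 < t < b ->
     is_derive X t (r * X t * (1 + alpha * X t - X (t - 1)))) ->
  0 < L -> filterlim X (at_left b) (locally L) ->
  exists h w, 0 < h <= 1 / 2 /\
    (forall t, 0 < t < b -> w t = X t) /\
    (forall t, 0 < t < b + h ->
       is_derive w t (r * w t * (1 + alpha * w t - X (t - 1)))).
Proof.
intros Hb HXc HXpos HXd HL HXL.
(* Capping the delayed time at [b - 1 / 2] keeps it left of [b], so [g] is continuous everywhere; it
   is the true coefficient up to [b + 1 / 2], whence [h <= 1 / 2]. *)
set (g := fun t => r * (1 - X (Rmin (t - 1) (b - 1 / 2)))).
assert (Hg : forall t, t <= b + 1 / 2 -> g t = r * (1 - X (t - 1))).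
{ intros t Ht. unfold g. now rewrite Rmin_left by lra. }
assert (gc : forall t, continuous g t).
{ intros t. unfold g.
  apply (continuous_comp (fun t => X (Rmin (t - 1) (b - 1 / 2)))
           (fun z => r * (1 - z))).
  - apply (continuous_comp (fun t => Rmin (t - 1) (b - 1 / 2)) X).
    + apply (continuous_Rmin (fun t => t - 1) (fun _ => b - 1 / 2)).
      * apply (ex_derive_continuous (V := R_NormedModule)). auto_derive. exact I.
      * apply continuous_const.
    + apply HXc. assert (A := Rmin_r (t - 1) (b - 1 / 2)). lra.
  - apply (ex_derive_continuous (V := R_NormedModule)). auto_derive. exact I. }
assert (antiderivative_exists : forall f : R -> R, (forall t, continuous f t) ->
  exists F : R -> R, forall t, is_derive F t (f t)).
{ intros f fc. exists (RInt f 0). intros t.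
  apply (is_derive_RInt f (RInt f 0) 0 t); [|apply fc].
  apply filter_forall. intros u. apply (RInt_correct f).
  apply (ex_RInt_continuous f). intros z _. apply fc. }
destruct (antiderivative_exists g gc) as [G HG].
destruct (antiderivative_exists (fun t => exp (G t))) as [H HH].
{ intros t. apply (continuous_comp G exp).
  - apply (ex_derive_continuous (V := R_NormedModule)). eexists; apply HG.
  - apply (ex_derive_continuous (V := R_NormedModule)). auto_derive. exact I. }
(* With v = 1/X the equation is v' = - r alpha - g v. The integrating factor [exp (G t)] makes [N] a
   first integral. *)
set (N := fun t => exp (G t) / X t + r * alpha * H t).
assert (HN : forall t, 0 < t < b -> is_derive N t 0).
{ intros t Ht. assert (P := HXpos t Ht). unfold N. auto_derive.
  - repeat split; try lra; eexists; [apply HG|now apply HXd|apply HH].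
  - rewrite (is_derive_unique (fun z : R => G z) _ _ (HG t)), (is_derive_unique (fun z : R => H z) _ _ (HH t)),
      (is_derive_unique (fun z : R => X z) _ _ (HXd t Ht)), Hg by lra.
    field. lra. }
assert (Nle : forall s t, 0 < s < t -> t < b -> N t = N s).
{ intros s t Hs Ht.
  destruct (mean_value N (fun _ => 0) s t) as [xi [_ E]]; [lra| | |lra].
  - intros u Hu. apply HN. lra.
  - intros u Hu. apply (ex_derive_continuous (V := R_NormedModule)).
    eexists. apply HN. lra. }
set (C := N (b / 2)).
assert (Nconst : forall t, 0 < t < b -> N t = C).
{ intros t Ht. unfold C.
  destruct (Rtotal_order t (b / 2)) as [Hlt|[->|Hgt]].
  - symmetry. apply Nle; lra.
  - reflexivity.
  - apply Nle; lra. }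
(* Solving [N t = C] for 1/X gives a formula that makes sense for every [t]. *)
set (v := fun t => (C - r * alpha * H t) * exp (- G t)).
assert (vX : forall t, 0 < t < b -> v t = / X t).
{ intros t Ht. assert (P := HXpos t Ht). unfold v.
  rewrite <- (Nconst t Ht). unfold N. rewrite exp_Ropp.
  assert (Q := exp_pos (G t)). field. lra. }
assert (vd : forall t, is_derive v t (- (r * alpha) - g t * v t)).
{ intros t. unfold v. auto_derive.
  - repeat split; eexists; [apply HH|apply HG].
  - rewrite (is_derive_unique (fun z : R => G z) _ _ (HG t)), (is_derive_unique (fun z : R => H z) _ _ (HH t)).
    rewrite exp_Ropp. assert (Q := exp_pos (G t)). field. lra. }
assert (vc : forall t, continuous v t).
{ intros t. apply (ex_derive_continuous (V := R_NormedModule)).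
  eexists; apply vd. }
(* Both are the left limit of [v] at [b]. Positivity of this value keeps [v] invertible slightly
   beyond [b]. *)
assert (vb : v b = / L).
{ apply (filterlim_locally_unique (V := R_NormedModule) (F := at_left b) v).
  - apply (filterlim_filter_le_1 v (filter_le_within (F := locally b) _)).
    apply vc.
  - apply (filterlim_ext_loc (fun t => / X t)).
    + exists (mkposreal b Hb). intros t Ht Htb.
      change (Rabs (t - b) < b) in Ht. apply Rabs_def2 in Ht.
      symmetry. apply vX. lra.
    + apply (filterlim_comp _ _ _ X Rinv _ (locally L)); [assumption|].
      assert (K : continuous Rinv L); [|exact K].
      apply (ex_derive_continuous (V := R_NormedModule)). auto_derive. lra. }
assert (HvL : 0 < v b) by (rewrite vb; now apply Rinv_0_lt_compat).
destruct (continuous_pos v b (vc b) HvL) as [eps Heps].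
assert (He := cond_pos eps).
exists (Rmin eps (1 / 2)), (fun t => / v t).
assert (Hh1 := Rmin_l eps (1 / 2)).
assert (Hh2 := Rmin_r eps (1 / 2)).
split; [split; [apply Rmin_glb_lt; lra|assumption]|split].
- intros t Ht. rewrite vX by assumption. apply Rinv_inv.
- intros t Ht.
  assert (vp : 0 < v t).
  { destruct (Rlt_le_dec t b) as [Htb|Htb].
    - rewrite vX by lra. apply Rinv_0_lt_compat, HXpos. lra.
    - apply Heps. change (Rabs (t - b) < eps). apply Rabs_def1; lra. }
  replace (r * / v t * (1 + alpha * / v t - X (t - 1)))
    with (- (- (r * alpha) - g t * v t) / v t ^ 2).
  + apply (is_derive_inv v t); [apply vd|lra].
  + rewrite Hg by lra. field. lra.
Qed.

(** [continuous_on] gives continuity only relative to [-1, T). Clamping maps a whole neighbourhood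
    of [t] into that set, which yields ordinary continuity. *)
Lemma continuous_clamp (x : R -> R) (T : Rbar) :
  Rbar_lt 0 T ->
  continuous_on (fun t : R => -1 <= t /\ Rbar_lt t T) x ->
  forall t : R, Rbar_lt t T -> continuous (fun u => x (Rmax u (-1))) t.
Proof.
intros HT Hx t Ht.
assert (Hcl : forall u : R, Rbar_lt u T ->
  -1 <= Rmax u (-1) /\ Rbar_lt (Rmax u (-1)) T).
{ intros u Hu. split; [apply Rmax_r|].
  unfold Rmax. destruct (Rle_dec u (-1)); [|assumption].
  apply (Rbar_le_lt_trans _ 0); [simpl; lra|assumption]. }
apply (filterlim_comp _ _ _ (fun u => Rmax u (-1)) x _
  (within (fun u : R => -1 <= u /\ Rbar_lt u T) (locally (Rmax t (-1))))).
- intros P HP. unfold filtermap, within in *.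
  assert (K : continuous (fun u => Rmax u (-1)) t).
  { apply continuous_ext with (fun u => - Rmin (- u) 1).
    { intros u. unfold Rmin, Rmax.
      destruct (Rle_dec _ _); destruct (Rle_dec _ _); lra. }
    apply (continuous_opp (V := R_NormedModule)).
    apply (continuous_Rmin Ropp (fun _ => 1)); [|apply continuous_const].
    apply (continuous_opp (V := R_NormedModule)), continuous_id. }
  specialize (K _ HP). unfold filtermap in K.
  generalize (filter_and _ _ K (locally_Rbar_lt T t Ht)).
  apply filter_imp. intros u [H1 H2]. apply H1. now apply Hcl.
- apply Hx. now apply Hcl.
Qed.

(** Gluing [x] to the function [w] of [bernoulli_extension] produces a solution up to [b + h]. *)
Lemma solution_extends (r alpha b L : R) (phi x : R -> R) :
  is_solution r alpha phi x b ->
  (forall t, 0 < t < b -> 0 < x t) ->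
  0 < L -> filterlim x (at_left b) (locally L) ->
  ~ is_maximal_solution r alpha phi x b.
Proof.
intros Hsol Hpos HL Hlim [_ Hmax].
destruct Hsol as [HT [Hcont [Hhist [Hder0 Hder]]]]. simpl in HT.
(* Freezing [x] to the left of -1 makes it continuous at -1 from both sides. *)
set (X := fun u => x (Rmax u (-1))).
assert (Xx : forall t, -1 <= t -> X t = x t).
{ intros t Ht. unfold X. now rewrite Rmax_left. }
assert (Xloc : forall t, -1 < t -> locally t (fun u => x u = X u)).
{ intros t Ht. generalize (open_gt (-1) t Ht). apply filter_imp.
  intros u Hu. symmetry. apply Xx. simpl in Hu. lra. }
destruct (bernoulli_extension r alpha b L X) as [h [w [Hh [wX wd]]]].
- assumption.
- intros t Ht. now apply (continuous_clamp x b).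
- intros t Ht. rewrite Xx by lra. now apply Hpos.
- intros t Ht. rewrite !Xx by lra. apply (is_derive_ext_loc x).
  + apply Xloc. lra.
  + apply Hder; simpl; lra.
- assumption.
- apply (filterlim_ext_loc x); [|assumption].
  apply filter_le_within. apply Xloc. lra.
(* As [x] and [w] agree on (0, b), [y] equals [x] before [b] and [w] at all positive times; no
   separate matching at [b] is needed. *)
- set (y := fun t => if Rlt_dec t b then x t else w t).
  assert (yx : forall t, t < b -> y t = x t).
  { intros t Ht. unfold y. destruct (Rlt_dec t b); [reflexivity|lra]. }
  assert (yw : forall t, 0 < t -> y t = w t).
  { intros t Ht. unfold y. destruct (Rlt_dec t b); [|reflexivity].
    rewrite wX by lra. symmetry. apply Xx. lra. }
  assert (yxloc : forall t, t < b -> locally t (fun u => x u = y u)).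
  { intros t Ht. generalize (open_lt b t Ht). apply filter_imp.
    intros u Hu. symmetry. now apply yx. }
  assert (yd : forall t, 0 < t < b + h ->
    is_derive y t (r * y t * (1 + alpha * y t - y (t - 1)))).
  { intros t Ht. rewrite (yw t), (yx (t - 1)), <- (Xx (t - 1)) by lra.
    apply (is_derive_ext_loc w); [|now apply wd].
    generalize (open_gt 0 t (proj1 Ht)). apply filter_imp.
    intros u Hu. symmetry. now apply yw. }
  enough (Hle : Rbar_le (b + h) b) by (simpl in Hle; lra).
  apply (Hmax y); [|intros t _ Ht; now apply yx].
  split; [simpl; lra|split; [|split; [|split]]].
  + intros t [Ht1 Ht2]. simpl in Ht2.
    destruct (Rlt_le_dec t b) as [Htb|Htb].
    * rewrite (yx t Htb).
      apply (filterlim_ext_loc x).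
      { apply filter_le_within. now apply yxloc. }
      (* Near a point [t < b] the old and the extended domain coincide. *)
      intros P HP. assert (Q := Hcont t (conj Ht1 Htb) P HP).
      unfold filtermap, within in *.
      generalize (filter_and _ _ Q (open_lt b t Htb)).
      apply filter_imp. intros u [Hu1 Hu2] [Hu3 _]. now apply Hu1.
    * apply (filterlim_filter_le_1 y (filter_le_within (F := locally t) _)).
      apply (ex_derive_continuous (V := R_NormedModule)).
      eexists. apply yd. lra.
  + intros s Hs. rewrite yx by lra. now apply Hhist.
  + rewrite (yx 0), (yx (0 - 1)) by lra.
    apply (filterlim_ext_loc (fun t => (x t - x 0) / (t - 0))); [|assumption].
    apply filter_le_within.
    generalize (yxloc 0 HT). apply filter_imp. now intros u ->.
  + intros t Ht1 Ht2. apply yd. split; assumption.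
Qed.

(** * Normalization and conclusion *)

Theorem theorem4 (r alpha c : R) (hr : 0 < r) (halpha : alpha = exp (- r))
  (hc : 0 < c) (phi : R -> R)
  (hphi_cont : continuous_on (fun s : R => -1 <= s <= 0) phi)
  (hphi : forall s : R, -1 <= s <= 0 -> 0 < phi s <= c * exp (r * s))
  (hphi0 : phi 0 = c) (hphi1 : phi (-1) < c * exp (- r))
  (x : R -> R) (T : Rbar) (hx : is_maximal_solution r alpha phi x T) :
  (forall t : R, 0 < t -> Rbar_lt t T -> c * exp (r * t) < x t) /\
  blows_up_at_finite_time x T.
Proof.
destruct (proj1 hx) as [HT [Hcont [Hhist [_ Hder]]]].
set (p := fun t => r * alpha * exp (r * t)).
set (Y := fun t => x (Rmax t (-1)) * exp (- (r * t))).
assert (Yx : forall t, -1 <= t -> Y t = x t * exp (- (r * t))).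
{ intros t Ht. unfold Y. now rewrite Rmax_left. }
assert (xY : forall t, -1 <= t -> x t = Y t * exp (r * t)).
{ intros t Ht. rewrite Yx by assumption.
  rewrite Rmult_assoc, <- exp_plus, Rplus_opp_l, exp_0. ring. }
assert (ra : 0 < r * alpha).
{ rewrite halpha. apply Rmult_lt_0_compat; [assumption|apply exp_pos]. }
assert (hp : forall t, 0 <= t -> 0 < p t).
{ intros t _. unfold p. apply Rmult_lt_0_compat; [assumption|apply exp_pos]. }
assert (Yc : forall t : R, Rbar_lt t T -> continuous Y t).
{ intros t Ht. apply (continuous_mult (K := R_AbsRing)).
  - now apply (continuous_clamp x T).
  - apply (ex_derive_continuous (V := R_NormedModule)). auto_derive. exact I. }
(* The linear term cancels. Since [alpha = exp (- r)], the delayed term x(t-1) is alpha e^(rt)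
   Y(t-1), with the same factor as alpha x(t). *)
assert (Yd : forall t : R, 0 < t -> Rbar_lt t T ->
  is_derive Y t (p t * Y t * (Y t - Y (t - 1)))).
{ intros t H0 Ht.
  apply (is_derive_ext_loc (fun u => x u * exp (- (r * u)))).
  { generalize (open_gt 0 t H0). apply filter_imp.
    intros u Hu. symmetry. apply Yx. simpl in Hu. lra. }
  assert (D := Hder t H0 Ht).
  auto_derive.
  - eexists. exact D.
  - rewrite (is_derive_unique (fun z : R => x z) _ _ D).
    rewrite (Yx t), (Yx (t - 1)) by lra. unfold p. rewrite halpha.
    replace (- (r * (t - 1))) with (r + - (r * t)) by ring.
    rewrite exp_plus, !exp_Ropp.
    assert (Q1 := exp_pos r). assert (Q2 := exp_pos (r * t)). field. lra. }
assert (Y0 : Y 0 = c).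
{ rewrite Yx, Hhist, hphi0 by lra. rewrite Rmult_0_r, Ropp_0, exp_0. ring. }
assert (Yh : forall s, -1 <= s <= 0 -> Y s <= Y 0).
{ intros s Hs. rewrite Y0, Yx, Hhist by lra. destruct (hphi s Hs) as [_ A].
  rewrite exp_Ropp. assert (Q := exp_pos (r * s)).
  apply Rmult_le_reg_r with (exp (r * s)); [assumption|].
  rewrite Rmult_assoc, Rinv_l by lra. lra. }
assert (Y1 : Y (-1) < Y 0).
{ rewrite Y0, Yx, Hhist by lra.
  replace (- (r * -1)) with r by ring.
  assert (Q := exp_pos r). rewrite exp_Ropp in hphi1.
  apply Rmult_lt_compat_r with (r := exp r) in hphi1; [|assumption].
  rewrite Rmult_assoc, Rinv_l in hphi1 by lra. lra. }
assert (Y0pos : 0 < Y 0) by lra.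
assert (Yinc := strictly_increasing p Y T hp Yc Yd Y0pos Yh Y1).
assert (Yge := ge_initial p Y T hp Yc Yd Y0pos Yh Y1).
split.
{ intros t H0 Ht. rewrite xY by lra. rewrite <- Y0.
  apply Rmult_lt_compat_r; [apply exp_pos|].
  apply Yinc; [lra|assumption]. }
assert (Hfin : T <> p_infty).
{ apply (interval_finite p Y T hp Yc Yd Y0pos Yh Y1).
  (* The threshold makes [r * t] at least [M / (r * alpha)], and exp u >= 1 + u finishes. *)
  intros M. exists (M / (r * alpha) / r). intros t Ht. unfold p.
  assert (M / (r * alpha) <= r * t).
  { apply Rmult_le_compat_r with (r := r) in Ht; [|lra].
    replace (M / (r * alpha) / r * r) with (M / (r * alpha)) in Ht
      by (field; split; nra).
    lra. }
  assert (A := exp_ineq1_le (r * t)).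
  replace M with (r * alpha * (M / (r * alpha))) by (field; split; nra).
  apply Rmult_le_compat_l; lra. }
destruct T as [b| |]; [|contradiction|contradiction].
simpl in HT. exists b. split; [reflexivity|].
destruct (increasing_limit_left x b HT) as [Hinf|[L [HL0 HL]]].
- intros s t Hs Ht. rewrite !xY by lra.
  assert (Y s < Y t) by (apply Yinc; [lra|assumption]).
  assert (Y 0 <= Y s) by (apply Yge; [lra|simpl; lra]).
  assert (exp (r * s) < exp (r * t)) by (apply exp_increasing; nra).
  assert (Q := exp_pos (r * s)). nra.
- assumption.
- exfalso. apply (solution_extends r alpha b L phi x); try assumption.
  + apply hx.
  + intros t Ht. rewrite xY by lra. apply Rmult_lt_0_compat; [|apply exp_pos].
    assert (Y 0 <= Y t) by (apply Yge; [lra|simpl; lra]). lra.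
  + rewrite Hhist, hphi0 in HL0 by lra. lra.
Qed.
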